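(* Let $G=(V,E)$ be a finite simple graph and $\lambda\in\mathbb{Z}_{>0}^V$. Then \[ \widetilde\chi^\lambda_G(q,x) \;=\; q^{ \Lambda_V } \sum_{\text{flats }S\subseteq E}\mu(\varnothing,S) \prod_{C \in P(S)} \frac{1-(1+qx-x)^{\Lambda_C}}{1-q^{\Lambda_C}} . \] In particular, if $T=(V,E)$ is a tree, then \[ \widetilde\chi^\lambda_T(q,x) \;=\; q^{ \Lambda_V } \sum_{S\subseteq E}(-1)^{|S|} \prod_{C \in P(S)} \frac{1-(1+qx-x)^{\Lambda_C}}{1-q^{\Lambda_C}} . \]
   Context: $\chi_G^\lambda(q,n):=\sum_c q^{\sum_v\lambda_v c(v)}$ over proper colorings $c:V\to\{1,\dots,n\}$ ($c(v)\ne c(w)$ whenever $vw\in E$); $\widetilde{\chi}^\lambda_G(q,x)$ is the unique polynomial in $\mathbb{Q}(q)[x]$ with $\widetilde{\chi}^\lambda_G(q,[n]_q)=\chi_G^\lambda(q,n)$ for all positive integers $n$, where $[n]_q=\frac{1-q^n}{1-q}$. A flat of $G$ is a subset $S\subseteq E$ such that for every edge $e\notin S$, the graph $(V,S)$ has strictly more connected components than $(V,S\cup\{e\})$. The flats, ordered by inclusion, form a lattice with Möbius function $\mu$. $P(S)$ is the collection of vertex sets of the connected components of $(V,S)$. For $W\subseteq V$, $\Lambda_W:=\sum_{v\in W}\lambda_v$. *)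

(* Defs.v *)
From mathcomp Require Import all_boot all_order all_algebra.
From Stdlib Require Import ClassicalEpsilon.

Set Implicit Arguments.
Unset Strict Implicit.
Unset Printing Implicit Defensive.

Import Order.TTheory GRing.Theory Num.Theory.
Local Open Scope ring_scope.

(* The field Q(q). *)
Notation Qq := {fraction {poly rat}}.
Definition q : Qq := tofrac 'X.

Definition qint (n : nat) : Qq := (1 - q ^+ n) / (1 - q).

(* Möbius function of a family L of sets ordered by inclusion.  The recursion
   is on the cardinality of the upper argument; the value is 0 unless A is
   contained in B. *)
Section Moebius.
Variables (T : finType) (L : {set {set T}}).

Fixpoint moebius_rec (n : nat) (A B : {set T}) : int :=
  if A == B then 1 else
  if n is n'.+1 then
    - \sum_(C in L | (A \subset C) && (C \proper B)) moebius_rec n' A C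
  else 0.

Definition moebius (A B : {set T}) : int := moebius_rec #|B| A B.

Lemma moebius_rec_fuel n (A B : {set T}) : (#|B| <= n)%N -> moebius_rec n A B = moebius A B.
Proof.
suff fuel m1 m2 (D : {set T}) : (#|D| <= m1)%N -> (#|D| <= m2)%N ->
    moebius_rec m1 A D = moebius_rec m2 A D by move=> leBn; apply: fuel.
elim: m1 m2 D => [|m1 IH] [|m2] D //=.
- rewrite leqn0 cards_eq0 => /eqP-> _.
  by rewrite big1 ?oppr0 // => C /and3P[_ _]; rewrite properE sub0set andbF.
- move=> _; rewrite leqn0 cards_eq0 => /eqP->.
  by rewrite big1 ?oppr0 // => C /and3P[_ _]; rewrite properE sub0set andbF.
move=> leD1 leD2; case: eqP => // _; congr (- _).
apply: eq_bigr => C /and3P[_ _ /proper_card ltCD].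
by apply: IH; rewrite -ltnS; apply: leq_trans ltCD _.
Qed.

Lemma moebius_refl (A : {set T}) : moebius A A = 1.
Proof. by rewrite /moebius; case: #|A| => [|n] /=; rewrite eqxx. Qed.

Lemma moebius_sum (A B : {set T}) : B \in L -> A \proper B ->
  \sum_(C in L | (A \subset C) && (C \subset B)) moebius A C = 0.
Proof.
move=> LB ltAB; have leAB := proper_sub ltAB.
rewrite (bigD1 B) /= ?LB ?leAB ?subxx //.
rewrite {1}/moebius; have ltB := leq_ltn_trans (leq0n _) (proper_card ltAB).
case EB: #|B| ltB => [//|n] _ /=.
have /negPf-> : A != B by apply: contraTneq ltAB => ->; rewrite properxx.
apply/eqP; rewrite addrC subr_eq0; apply/eqP.
apply: eq_big => [C|C /andP[/and3P[_ _ leCB] neCB]].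
  by rewrite properEneq -!andbA; do !bool_congr.
rewrite moebius_rec_fuel // -ltnS -EB.
by apply: proper_card; rewrite properEneq neCB.
Qed.

End Moebius.

(* A finite simple graph is a finite type V of vertices with a symmetric and
   irreflexive adjacency relation e; edges are two-element sets of vertices. *)
Section Graph.
Variables (V : finType) (e : rel V).

Definition edges : {set {set V}} := [set [set p.1; p.2] | p : V * V & e p.1 p.2].

Definition adj (S : {set {set V}}) : rel V :=
  fun v w => (v != w) && ([set v; w] \in S).

(* P(S) *)
Definition components (S : {set {set V}}) : {set {set V}} :=
  equivalence_partition (connect (adj S)) [set: V].

Definition is_flat (S : {set {set V}}) : bool :=
  (S \subset edges) &&
  [forall x in edges :\: S, (#|components (x |: S)| < #|components S|)%N].

Definition flats : {set {set {set V}}} := [set S | is_flat S].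

Definition is_tree : Prop :=
  [/\ (0 < #|V|)%N, forall v w : V, connect e v w
    & forall c : seq V, (2 < size c)%N -> ~ ucycle e c].

Definition proper_coloring (n : nat) (c : {ffun V -> 'I_n}) : bool :=
  [forall v, forall w, e v w ==> (c v != c w)].

Variable lam : V -> nat.

Definition Lam (W : {set V}) : nat := (\sum_(v in W) lam v)%N.

(* The color i : 'I_n stands for i.+1 in {1, ..., n}. *)
Definition qchrom (n : nat) : Qq :=
  \sum_(c : {ffun V -> 'I_n} | proper_coloring c)
    q ^+ (\sum_v lam v * (c v).+1)%N.

Definition is_qchrom_poly (p : {poly Qq}) : Prop :=
  forall n : nat, (0 < n)%N -> p.[qint n] = qchrom n.

(* The p such that is_qchrom_poly p: p is determined by its values at the
   infinitely many distinct points qint n.  If no such p existed, epsilon would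
   return an unspecified polynomial. *)
Definition qchrom_poly : {poly Qq} := epsilon (inhabits 0) is_qchrom_poly.

End Graph.

(* (1 - (1 + q x - x)^m) / (1 - q^m), as a polynomial in x. *)
Definition component_factor (m : nat) : {poly Qq} :=
  (1 - q ^+ m)^-1 *: (1 - (1 + q *: 'X - 'X) ^+ m).

(* Main.v *)
(* At x = [n]_q one has 1 + qx - x = q^n, so q^{Lam_C} times the factor of a
   block C is the geometric sum of q^{Lam_C i} over 1 <= i <= n, and the product
   over the components of (V,S) enumerates the colorings that are constant on
   every edge of S.  Summing over S and exchanging the sums, a coloring c is
   counted with coefficient the sum of mu(0,S), resp. (-1)^{|S|}, over the S
   contained in the set of c-monochromatic edges; this set is a flat, and the
   coefficient is 1 if it is empty and 0 otherwise. *)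
Require Import Defs.
From mathcomp Require Import all_boot all_order all_algebra.
From Stdlib Require Import ClassicalEpsilon.

Set Implicit Arguments.
Unset Strict Implicit.
Unset Printing Implicit Defensive.

Import Order.TTheory GRing.Theory Num.Theory.
Local Open Scope ring_scope.

(** * Powers of [q] and interpolation at the q-integers *)

Lemma q_exp_inj : injective (fun n => q ^+ n).
Proof.
move=> m n; rewrite /q -!rmorphXn => /eqP; rewrite tofrac_eq => /eqP eqX.
by apply: succn_inj; rewrite -(size_polyXn rat m) eqX size_polyXn.
Qed.

Lemma subr1_q_exp_neq0 m : (0 < m)%N -> 1 - q ^+ m != 0.
Proof.
move=> m_gt0; rewrite subr_eq0; apply: contraTneq m_gt0 => q1.
(* The [1] on the left of [q1] is read as [q ^+ 0]. *)
by rewrite -(q_exp_inj (x1 := 0%N) q1).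
Qed.

Lemma qint_inj : injective qint.
Proof.
have q1 : (1 - q)^-1 != 0 by rewrite invr_eq0 -[q]expr1 subr1_q_exp_neq0.
by move=> m n /(mulIf q1) /subrI /q_exp_inj.
Qed.

(** A nonzero [p - r] has fewer distinct roots than its size, yet it would vanish at that many
    distinct points [qint i] with [i] positive. *)
Lemma poly_qint_inj (p r : {poly Qq}) :
  (forall n, (0 < n)%N -> p.[qint n] = r.[qint n]) -> p = r.
Proof.
move=> eq_pr; apply/eqP; rewrite -subr_eq0; apply/negPn/negP => pr_neq0.
pose s := [seq qint i | i <- iota 1 (size (p - r))].
have all_s : all (root (p - r)) s.
  apply/allP => x /mapP[i]; rewrite mem_iota => /andP[i_gt0 _] ->.
  by rewrite rootE hornerD hornerN eq_pr // subrr.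
have uniq_s : uniq s by rewrite (map_inj_uniq qint_inj) iota_uniq.
by have := max_poly_roots pr_neq0 all_s uniq_s; rewrite size_map size_iota ltnn.
Qed.

(** * Values of the component factors at q-integers *)

Lemma horner_geometric_sum (F : fieldType) (a : F) m n :
  1 - a != 0 -> 1 - a ^+ m != 0 ->
  a ^+ m * ((1 - a ^+ m)^-1 *:
    (1 - (1 + a *: 'X - 'X) ^+ m)).[(1 - a ^+ n) / (1 - a)] =
  \sum_(i < n) a ^+ (m * i.+1).
Proof.
move=> a1 am1; have base : (1 + a *: 'X - 'X).[(1 - a ^+ n) / (1 - a)] = a ^+ n.
  rewrite !(hornerD, hornerN, hornerZ, hornerX, hornerC); set x := _ / _.
  have -> : 1 + a * x - x = 1 - x * (1 - a).
    by rewrite mulrBr mulr1 opprB addrA (mulrC a).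
  by rewrite divfK // opprB addrC subrK.
(* Regrouping [a ^+ (n * m)] as [(a ^+ m) ^+ n] makes [1 - a ^+ m] the factor that [subrX1]
   extracts, and it cancels the denominator. *)
rewrite hornerZ hornerD hornerN hornerC horner_exp base -exprM mulnC exprM.
rewrite -[1 - _ ^+ n]opprB subrX1 -mulNr opprB mulKf // mulr_sumr.
by apply: eq_bigr => i _; rewrite mulnS exprD exprM.
Qed.

Lemma component_factor_qint m n : (0 < m)%N ->
  q ^+ m * (component_factor m).[qint n] = \sum_(i < n) q ^+ (m * i.+1).
Proof.
move=> m_gt0; apply: horner_geometric_sum; last exact: subr1_q_exp_neq0.
by rewrite -[q]expr1 subr1_q_exp_neq0.
Qed.

(** * Alternating sums over subsets and products over partitions *)

Lemma sum_subset_sign (T : finType) (M : {set T}) :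
  \sum_(S : {set T} | S \subset M) (-1) ^+ #|S| = (M == set0)%:R :> int.
Proof.
(* Expanding the product of the [F x + 1] gives one term for each set [S]: it is [(-1) ^+ #|S|] if
   [S] lies in [M], and 0 otherwise. Any element of [M] makes the whole product 0. *)
pose F x : int := if x \in M then -1 else 0.
have <- : \prod_x (F x + 1) = (M == set0)%:R.
  case: (set_0Vmem M) => [M0|[x Mx]].
    by rewrite M0 eqxx big1 // => x _; rewrite /F M0 inE add0r.
  rewrite (bigD1 x) //= /F Mx addNr mul0r; case: eqP => // M0.
  by move: Mx; rewrite M0 inE.
rewrite bigA_distr [RHS](bigID (fun S : {set T} => S \subset M)) /=.
rewrite [X in _ + X]big1 ?addr0 => [|S /subsetPn[x Sx Mx]]; last first.
  by rewrite (bigD1 x) //= Sx /F (negPf Mx) mul0r.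
apply: eq_bigr => S /subsetP SM; rewrite -big_mkcond /=.
by rewrite -prodr_const; apply: eq_bigr => x /SM Mx; rewrite /F Mx.
Qed.

(** By distributivity the product is a sum over choices of one [j] for each block, and these choices
    are the functions on [T] that are constant on blocks. *)
Lemma prod_partition_sum (R : comPzRingType) (T J : finType) (j0 : J)
    (P : {set {set T}}) (F : T -> J -> R) : partition P [set: T] ->
  \prod_(C in P) \sum_j \prod_(v in C) F v j =
  \sum_(c : {ffun T -> J} |
        [forall v, forall w, (pblock P v == pblock P w) ==> (c v == c w)])
    \prod_v F v (c v).
Proof.
move=> partP; have /and3P[/eqP covP trP nP0] := partP.
have in_pblock v : v \in pblock P v by rewrite mem_pblock covP inE.
have P_pblock v : pblock P v \in P by rewrite pblock_mem ?covP.
have pickP C : C \in P -> exists2 x, x \in C & [pick x in C] = Some x.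
  move=> PC; case: pickP => [x Cx|C0]; first by exists x.
  case/negP: nP0; rewrite -(_ : C = set0) //.
  by apply/setP => x; rewrite inE; apply: C0.
rewrite (big_distr_big j0) /=.
(* [h] reads [c] at a representative of each block, and [h'] spreads the value of a block over its
   elements. Outside [P] the value must be the default [j0], as in the index set produced by
   [big_distr_big]. *)
pose h (c : {ffun T -> J}) := [ffun C : {set T} =>
  if C \in P then if [pick x in C] is Some x then c x else j0 else j0].
pose h' (f : {ffun {set T} -> J}) := [ffun v => f (pblock P v)].
rewrite (reindex_onto h h') => [|f /pffun_onP[/subsetP fP _]]; last first.
  apply/ffunP => C; rewrite ffunE; case: ifPn => [PC|nPC].
    by have [x Cx ->] := pickP C PC; rewrite ffunE (def_pblock trP PC Cx).
  by apply/esym/eqP/negPn; apply: contra nPC => fC; apply: fP.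
have hE (c : {ffun T -> J}) C : C \in P ->
    [forall v, forall w, (pblock P v == pblock P w) ==> (c v == c w)] ->
    forall v, v \in C -> h c C = c v.
  move=> PC /forallP cP v Cv; rewrite ffunE PC; have [x Cx ->] := pickP C PC.
  apply/eqP; have /forallP/(_ v)/implyP := cP x; apply.
  by rewrite !(def_pblock trP PC).
(* The reindexing leaves the condition [h' (h c) = c], which says that [c] is constant on blocks. *)
apply: eq_big => [c|c /andP[_ /eqP hK]].
  apply/andP/idP => [[_ /eqP <-]|cP].
    apply/forallP => v; apply/forallP => w; apply/implyP => /eqP vw.
    by rewrite !ffunE vw.
  split.
    apply/pffun_onP; split=> //; apply/subsetP => C.
    by rewrite !inE ffunE; case: ifP => //; rewrite eqxx.
  apply/eqP/ffunP => v; rewrite ffunE.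
  exact: (hE c _ (P_pblock v) cP).
have -> : \prod_v F v (c v) = \prod_(v in [set: T]) F v (c v).
  by apply: eq_bigl => v; rewrite inE.
rewrite (set_partition_big _ partP) /=; apply: eq_bigr => C PC.
apply: eq_bigr => v Cv; congr (F v _).
by rewrite -[in RHS]hK [RHS]ffunE (def_pblock trP PC Cv).
Qed.

(** * Connected components of an edge set *)

Lemma adj_sym (V : finType) (S : {set {set V}}) : symmetric (adj S).
Proof. by move=> v w; rewrite /adj eq_sym setUC. Qed.

Lemma connect_adj_equiv (V : finType) (S : {set {set V}}) :
  {in [set: V] & &, equivalence_rel (connect (adj S))}.
Proof.
move=> u v w _ _ _; split=> [|uv]; first exact: connect0.
exact: (same_connect (sym_connect_sym (adj_sym S)) uv).
Qed.

Lemma components_partition (V : finType) (S : {set {set V}}) :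
  partition (components S) [set: V].
Proof. exact: equivalence_partitionP (@connect_adj_equiv V S). Qed.

Lemma eq_pblock_components (V : finType) (S : {set {set V}}) v w :
  (pblock (components S) v == pblock (components S) w) = connect (adj S) v w.
Proof.
have /and3P[/eqP cov tr _] := components_partition S.
rewrite eq_pblock ?cov // pblock_equivalence_partition ?inE //.
exact: connect_adj_equiv.
Qed.

(** Sending each component of [S] to the component of [S'] that contains it is onto, but not
    injective: the components of [v] and [w] are distinct and get merged. *)
Lemma card_components_setU1 (V : finType) (S : {set {set V}}) v w :
  ~~ connect (adj S) v w -> (#|components ([set v; w] |: S)| < #|components S|)%N.
Proof.
set S' := _ |: S => nvw.
have subS : subrel (connect (adj S)) (connect (adj S')).
  apply: connect_sub => x y /andP[xy Sxy]; apply: connect1.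
  by rewrite /adj xy inE Sxy orbT.
have /and3P[/eqP cov tr _] := components_partition S.
have /and3P[/eqP cov' tr' nP0'] := components_partition S'.
pose f (B : {set V}) :=
  if [pick x in B] is Some x then pblock (components S') x else set0.
have fE x : f (pblock (components S) x) = pblock (components S') x.
  rewrite /f; case: pickP => [y /= xy|/(_ x)]; last by rewrite mem_pblock cov inE.
  apply/eqP; rewrite eq_sym eq_pblock_components; apply: subS.
  by rewrite -eq_pblock_components (same_pblock tr xy).
have sub_im : components S' \subset f @: components S.
  apply/subsetP => C PC; have [C0|[x Cx]] := set_0Vmem C.
    by rewrite -C0 PC in nP0'.
  rewrite -(def_pblock tr' PC Cx) -fE; apply/imset_f.
  by rewrite pblock_mem ?cov.
apply: leq_ltn_trans (subset_leq_card sub_im) _.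
rewrite ltn_neqAle leq_imset_card andbT; apply: contra nvw => /imset_injP inj_f.
have [->|vw] := eqVneq v w; first exact: connect0.
rewrite -eq_pblock_components; apply/eqP/inj_f; rewrite ?pblock_mem ?cov //.
apply/eqP; rewrite !fE eq_pblock_components; apply: connect1.
by rewrite /adj vw !inE eqxx.
Qed.

(** * Monochromatic edges of a coloring *)

(** Quantifying over all pairs in [x] avoids choosing an order of its endpoints. Colors in any
    [eqType] allow the vertices themselves as colors. *)
Definition mono_edges (V : finType) (e : rel V) (J : eqType) (c : V -> J) :
  {set {set V}} :=
  [set x in edges e | [forall v in x, forall w in x, c v == c w]].

Lemma mem_edges (V : finType) (e : rel V) v w : e v w -> [set v; w] \in edges e.
Proof. by move=> evw; apply/imsetP; exists (v, w); rewrite ?inE. Qed.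

Lemma mem_mono_edges (V : finType) (e : rel V) (J : eqType) (c : V -> J) v w :
  e v w -> ([set v; w] \in mono_edges e c) = (c v == c w).
Proof.
move=> evw; rewrite inE mem_edges //=; apply/idP/eqP => [/forall_inP cP|cvw].
  have /forall_inP/(_ w) := cP v (set21 v w).
  by rewrite set22 => /(_ isT)/eqP.
apply/forall_inP => x /set2P xvw; apply/forall_inP => y /set2P yvw.
by case: xvw => ->; case: yvw => ->; rewrite ?cvw.
Qed.

Lemma connect_mono_edges (V : finType) (e : rel V) (J : eqType) (c : V -> J)
    (S : {set {set V}}) v w :
  S \subset mono_edges e c -> connect (adj S) v w -> c v = c w.
Proof.
move=> /subsetP SM /connectP[p pth ->]; elim: p v pth => //= u p IH v.
case/andP=> /andP[_ /SM]; rewrite inE => /andP[_ /forall_inP cP] /IH <-.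
have /forall_inP/(_ u) := cP v (set21 v u).
by rewrite set22 => /(_ isT)/eqP.
Qed.

(** This puts the condition on [S] in the form of the index set of [prod_partition_sum].
    Irreflexivity gives an edge two distinct ends, as [adj] requires. *)
Lemma sub_mono_edges (V : finType) (e : rel V) (J : eqType) (c : V -> J)
    (S : {set {set V}}) :
  irreflexive e -> S \subset edges e ->
  (S \subset mono_edges e c) =
  [forall v, forall w,
     (pblock (components S) v == pblock (components S) w) ==> (c v == c w)].
Proof.
move=> e_irr /subsetP SE; apply/idP/forallP => [SM v|cP].
  apply/forallP => w; apply/implyP; rewrite eq_pblock_components => vw.
  by rewrite (connect_mono_edges SM vw).
apply/subsetP => x Sx; have /imsetP[[v w] /=] := SE x Sx.
rewrite inE => evw xE; rewrite xE mem_mono_edges //.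
have /forallP/(_ w)/implyP := cP v; apply.
rewrite eq_pblock_components; apply: connect1; rewrite /adj -xE Sx andbT.
by apply: contraTneq evw => ->; rewrite e_irr.
Qed.

(** Components of the monochromatic edges have a single color, so any other edge joins two different
    components. *)
Lemma mono_edges_flat (V : finType) (e : rel V) (J : eqType) (c : V -> J) :
  mono_edges e c \in flats e.
Proof.
rewrite inE /is_flat; apply/andP; split.
  by apply/subsetP => x; rewrite inE => /andP[].
apply/forall_inP => x; rewrite inE => /andP[nMx /imsetP[[v w] /=]].
rewrite inE => evw xE; move: nMx; rewrite {}xE mem_mono_edges // => cvw.
apply: card_components_setU1; apply: contra cvw => vw.
exact/eqP/(connect_mono_edges (subxx _) vw).
Qed.

(** With the identity as coloring, no edge is monochromatic. *)
Lemma set0_flat (V : finType) (e : rel V) : irreflexive e -> set0 \in flats e.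
Proof.
move=> e_irr; suff -> : set0 = mono_edges e id by apply: mono_edges_flat.
apply/esym/setP => x; rewrite [RHS]inE; apply/negP => Mx.
have := Mx; rewrite inE => /andP[/imsetP[[v w] /=]].
rewrite inE => evw xE _; move: Mx; rewrite xE mem_mono_edges // => /eqP vw.
by rewrite vw e_irr in evw.
Qed.

Lemma proper_mono_edges (V : finType) (e : rel V) n (c : {ffun V -> 'I_n}) :
  proper_coloring e c = (mono_edges e c == set0).
Proof.
apply/forallP/eqP => [cP|M0 v]; last first.
  apply/forallP => w; apply/implyP => evw.
  by rewrite -(mem_mono_edges _ evw) M0 inE.
apply/setP => x; rewrite [RHS]inE; apply/negP => Mx.
have := Mx; rewrite inE => /andP[/imsetP[[v w] /=]].
rewrite inE => evw xE _; move: Mx; rewrite xE mem_mono_edges //.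
by apply/negP; have /forallP/(_ w)/implyP := cP v; apply.
Qed.

(** * Expansions over edge sets *)

Lemma prod_component_factor (V : finType) (e : rel V) (lam : V -> nat)
    (S : {set {set V}}) n :
    irreflexive e -> (forall v, (0 < lam v)%N) -> S \subset edges e -> (0 < n)%N ->
  q ^+ Lam lam [set: V] *
    (\prod_(C in components S) component_factor (Lam lam C)).[qint n] =
  \sum_(c : {ffun V -> 'I_n} | S \subset mono_edges e c)
    q ^+ (\sum_v lam v * (c v).+1)%N.
Proof.
move=> e_irr lam_gt0 SE n_gt0; have partP := components_partition S.
rewrite {1}/Lam (set_partition_big _ partP) /= expr_sum horner_prod -big_split /=.
transitivity (\prod_(C in components S)
    \sum_(i < n) \prod_(v in C) q ^+ (lam v * i.+1)).
  apply: eq_bigr => C PC; rewrite component_factor_qint.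
    by apply: eq_bigr => i _; rewrite -expr_sum -big_distrl.
  (* Blocks are nonempty and weights positive, so [Lam lam C] is positive. *)
  have /and3P[_ _ nP0] := partP; case: (set_0Vmem C) => [C0|[v Cv]].
    by rewrite -C0 PC in nP0.
  by rewrite (bigD1 v) //= ltn_addr.
rewrite (prod_partition_sum (Ordinal n_gt0)) //.
by apply: eq_big => c => [|_]; rewrite ?(sub_mono_edges _ e_irr) // expr_sum.
Qed.

(** Common to both formulas: [Q] selects the edge sets and [a] their coefficients, and [aP] says
    that the total coefficient of a coloring indicates whether it is proper. *)
Lemma is_qchrom_poly_expansion (V : finType) (e : rel V) (lam : V -> nat)
    (Q : pred {set {set V}}) (a : {set {set V}} -> int) :
    irreflexive e -> (forall v, (0 < lam v)%N) ->
    (forall S, Q S -> S \subset edges e) ->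
    (forall n (c : {ffun V -> 'I_n}),
       \sum_(S | Q S && (S \subset mono_edges e c)) a S =
       (mono_edges e c == set0)%:R) ->
  is_qchrom_poly e lam
    (q ^+ Lam lam [set: V] *:
       \sum_(S | Q S) (a S)%:~R *
         \prod_(C in components S) component_factor (Lam lam C)).
Proof.
move=> e_irr lam_gt0 QE aP n n_gt0.
rewrite hornerZ horner_sum mulr_sumr.
transitivity (\sum_(S | Q S) \sum_(c : {ffun V -> 'I_n} | S \subset mono_edges e c)
    (a S)%:~R * q ^+ (\sum_v lam v * (c v).+1)%N).
  apply: eq_bigr => S QS; rewrite -(rmorph_int polyC) hornerM hornerC mulrCA.
  by rewrite (prod_component_factor e_irr lam_gt0 (QE _ QS) n_gt0) mulr_sumr.
rewrite (exchange_big_dep predT) //= /qchrom [RHS]big_mkcond /=.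
apply: eq_bigr => c _; rewrite -mulr_suml -rmorph_sum aP proper_mono_edges.
by case: eqP => _; rewrite ?mul1r ?mul0r.
Qed.

(** * Uniqueness and the two formulas *)

Lemma is_qchrom_poly_inj (V : finType) (e : rel V) (lam : V -> nat) p r :
  is_qchrom_poly e lam p -> is_qchrom_poly e lam r -> p = r.
Proof. by move=> pP rP; apply: poly_qint_inj => n n0; rewrite pP ?rP. Qed.

(** Once [p] witnesses existence, [epsilon] returns a polynomial with the same property, which
    equals [p] by uniqueness. *)
Lemma qchrom_polyE (V : finType) (e : rel V) (lam : V -> nat) p :
  is_qchrom_poly e lam p -> qchrom_poly e lam = p.
Proof.
move=> pP; apply: is_qchrom_poly_inj (pP).
by apply: (epsilon_spec (inhabits 0)); exists p.
Qed.

Theorem theorem20 (V : finType) (e : rel V)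
    (e_sym : symmetric e) (e_irr : irreflexive e)
    (lam : V -> nat) (lam_gt0 : forall v, (0 < lam v)%N) :
  [/\ exists! p : {poly Qq}, is_qchrom_poly e lam p,
      qchrom_poly e lam =
        q ^+ Lam lam [set: V] *:
          \sum_(S in flats e)
            (moebius (flats e) set0 S)%:~R *
            \prod_(C in components S) component_factor (Lam lam C)
    & is_tree e ->
      qchrom_poly e lam =
        q ^+ Lam lam [set: V] *:
          \sum_(S : {set {set V}} | S \subset edges e)
            (-1) ^+ #|S| *
            \prod_(C in components S) component_factor (Lam lam C)].
Proof.
have flatP : is_qchrom_poly e lam (q ^+ Lam lam [set: V] *:
    \sum_(S in flats e) (moebius (flats e) set0 S)%:~R *
      \prod_(C in components S) component_factor (Lam lam C)).
  apply: is_qchrom_poly_expansion => // [S|n c].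
    by rewrite inE => /andP[].
  have [->|M0] := eqVneq (mono_edges e c) set0.
    rewrite (big_pred1 set0) ?moebius_refl // => S.
    by rewrite subset0 andbC /=; case: eqP => //= ->; apply: set0_flat.
  (* The right-hand side is 0, the sum of the Möbius function over the interval from [set0] to the
     nonempty flat [mono_edges e c]. *)
  rewrite -[RHS](moebius_sum (mono_edges_flat e c) (A := set0)).
    by apply: eq_bigl => S; rewrite sub0set.
  by rewrite properEneq eq_sym M0 sub0set.
split; last 1 first.
- move=> _; apply: qchrom_polyE.
  (* The signs become images of integers, the form of the coefficients in
     [is_qchrom_poly_expansion]. *)
  under eq_bigr do rewrite -(rmorph_sign (intr : int -> {poly Qq})).
  apply: is_qchrom_poly_expansion => // n c; rewrite -sum_subset_sign.
  apply: eq_bigl => S; rewrite andb_idl // => /subset_trans; apply.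
  by apply/subsetP => x; rewrite inE => /andP[].
- by eexists; split=> [|r rP]; [exact: flatP|exact: is_qchrom_poly_inj rP].
- exact: qchrom_polyE.
Qed.
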